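(* Let $A\in\mathbb{R}^{n\times n}$ be positive definite and $b\in\mathbb{R}^n$. In exact arithmetic, SCG converges to the unique solution $x_\star$ of $Ax=b$ within $n+1$ steps, i.e. there is an index $k\le n+1$ such that $x_k$ is generated by SCG and $x_k=x_\star$.
   Context: A real square (not necessarily symmetric) matrix $A$ is positive definite if $x^TAx>0$ for all nonzero $x\in\mathbb{R}^n$. SCG (semi-conjugate gradient method). Set $x_0=0$, $r_0=b$, $p_0=r_0$, $q_0=Ap_0$. For $k=0,1,2,\dots$: compute $\alpha_k = p_k^Tr_k/(p_k^Tq_k)$, $x_{k+1}=x_k+\alpha_kp_k$, $r_{k+1}=r_k-\alpha_kq_k$; form $v_{k+1}=Ar_{k+1}$, $P_{k+1}=[p_0\ p_1\ \cdots\ p_k]$, $Q_{k+1}=[q_0\ q_1\ \cdots\ q_k]$, $L_{k+1}=P_{k+1}^TQ_{k+1}$, solve $L_{k+1}\lambda_{k+1}=P_{k+1}^Tv_{k+1}$ and set $p_{k+1}=r_{k+1}-P_{k+1}\lambda_{k+1}$, $q_{k+1}=v_{k+1}-Q_{k+1}\lambda_{k+1}$. The method stops as soon as $r_k=0$. Iteration $k$ is well defined when $p_k^Tq_k\neq0$ and $L_{k+1}$ is nonsingular; quantities with index $k$ are ''generated'' if iterations $0,\dots,k-1$ are well defined. *)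

(* Defs.v *)
From mathcomp Require Import all_boot all_order all_algebra.
From mathcomp Require Import reals.
Set Implicit Arguments.
Unset Strict Implicit.
Unset Printing Implicit Defensive.
Import Order.TTheory GRing.Theory Num.Theory.
Local Open Scope ring_scope.

(* No symmetry is required. *)
Definition posdef (R : realType) (n : nat) (A : 'M[R]_n) : Prop :=
  forall x : 'cV[R]_n, x != 0 -> 0 < (x^T *m A *m x) 0 0.

(* [M | c] *)
Definition append_col (R : realType) (n k : nat)
    (M : 'M[R]_(n, k)) (c : 'cV[R]_n) : 'M[R]_(n, k.+1) :=
  castmx (erefl n, addn1 k) (row_mx M c).

(* The data available on entering iteration k: x_k, r_k, p_k, q_k, together
   with P_k = [p_0 ... p_(k-1)] and Q_k = [q_0 ... q_(k-1)]. *)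
Record scg_state (R : realType) (n k : nat) : Type := ScgState {
  st_x : 'cV[R]_n;
  st_r : 'cV[R]_n;
  st_p : 'cV[R]_n;
  st_q : 'cV[R]_n;
  st_P : 'M[R]_(n, k);
  st_Q : 'M[R]_(n, k)
}.

(* P_(k+1), Q_(k+1) and L_(k+1) as formed during iteration k. *)
Definition next_P (R : realType) (n k : nat) (s : scg_state R n k) :
  'M[R]_(n, k.+1) := append_col (st_P s) (st_p s).
Definition next_Q (R : realType) (n k : nat) (s : scg_state R n k) :
  'M[R]_(n, k.+1) := append_col (st_Q s) (st_q s).
Definition next_L (R : realType) (n k : nat) (s : scg_state R n k) :
  'M[R]_k.+1 := (next_P s)^T *m next_Q s.

(* Division by zero and [invmx] of a singular matrix make this function total;
   iterations in which either occurs are excluded by [scg_well_defined]. *)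
Definition scg_step (R : realType) (n : nat) (A : 'M[R]_n) (k : nat)
    (s : scg_state R n k) : scg_state R n k.+1 :=
  let alpha := ((st_p s)^T *m st_r s) 0 0 / ((st_p s)^T *m st_q s) 0 0 in
  let x' := st_x s + alpha *: st_p s in
  let r' := st_r s - alpha *: st_q s in
  let v := A *m r' in
  let lambda := invmx (next_L s) *m ((next_P s)^T *m v) in
  ScgState x' r' (r' - next_P s *m lambda) (v - next_Q s *m lambda)
           (next_P s) (next_Q s).

Fixpoint scg (R : realType) (n : nat) (A : 'M[R]_n) (b : 'cV[R]_n) (k : nat) :
    scg_state R n k :=
  match k with
  | 0 => ScgState 0 b b (A *m b) 0 0
  | k'.+1 => scg_step A (scg A b k')
  end.

Definition scg_well_defined (R : realType) (n : nat) (A : 'M[R]_n)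
    (b : 'cV[R]_n) (k : nat) : Prop :=
  ((st_p (scg A b k))^T *m st_q (scg A b k)) 0 0 != 0 /\
  next_L (scg A b k) \in unitmx.

(* The conjunct on the residual is the stopping rule: iteration j is carried
   out only if r_j is nonzero. *)
Definition scg_generated (R : realType) (n : nat) (A : 'M[R]_n)
    (b : 'cV[R]_n) (k : nat) : Prop :=
  forall j : nat, (j < k)%N ->
    st_r (scg A b j) != 0 /\ scg_well_defined A b j.

(* Main.v *)
(* The directions are semi-conjugate: [p_i^T A p_j = 0] for [i < j], so each
   [L_k] is lower triangular with diagonal entries [p_j^T A p_j].  Moreover
   [P_k^T r_k = 0] and [p_k] differs from [r_k] by an element of the column
   space of [P_k], so [r_k != 0] forces [p_k != 0], hence [p_k^T q_k > 0], and
   the iteration is well defined.  The columns of [P_k] stay linearly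
   independent, so at most [n] iterations occur before the residual
   [r_k = b - A x_k] vanishes. *)
Require Import Defs.
From mathcomp Require Import all_boot all_order all_algebra.
From mathcomp Require Import reals.
Set Implicit Arguments.
Unset Strict Implicit.
Unset Printing Implicit Defensive.
Import Order.TTheory GRing.Theory Num.Theory.
Local Open Scope ring_scope.

Lemma dotmx_eq0 (R : realType) (n : nat) (x : 'cV[R]_n) :
  (x^T *m x) 0 0 = 0 -> x = 0.
Proof.
rewrite mxE => /eqP; rewrite psumr_eq0; last first.
  by move=> i _; rewrite !mxE -expr2 sqr_ge0.
move/allP=> x0; apply/matrixP=> i j; rewrite ord1 mxE.
have := x0 i (mem_index_enum _).
by rewrite !mxE -expr2 sqrf_eq0 => /eqP.
Qed.

Lemma posdef_ker (R : realType) (n : nat) (A : 'M[R]_n) (x : 'cV[R]_n) :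
  posdef A -> A *m x = 0 -> x = 0.
Proof.
move=> Apos Ax0; apply/eqP/negPn/negP => /Apos.
by rewrite -mulmxA Ax0 mulmx0 mxE ltxx.
Qed.

Lemma mulmx_append_col (R : realType) (m n k : nat) (B : 'M[R]_(m, n))
    (M : 'M[R]_(n, k)) (c : 'cV[R]_n) :
  B *m append_col M c = append_col (B *m M) (B *m c).
(* Eliminating [addn1 k] replaces the index [k.+1] by [k + 1], so the cast becomes trivial. *)
Proof. by rewrite /append_col; case: _ / (addn1 k); rewrite !castmx_id mul_mx_row. Qed.

Lemma append_col_orth (R : realType) (n k : nat) (M : 'M[R]_(n, k))
    (c y : 'cV[R]_n) :
  M^T *m y = 0 -> c^T *m y = 0 -> (append_col M c)^T *m y = 0.
Proof.
move=> My cy; rewrite /append_col; case: _ / (addn1 k).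
by rewrite castmx_id tr_row_mx mul_col_mx My cy col_mx0.
Qed.

(** Since [M^T *m d = 0], the upper right block vanishes, so the determinant is that of [M^T *m N]
    times the scalar [c^T *m d]. *)
Lemma append_col_gram_unit (R : realType) (n k : nat) (M N : 'M[R]_(n, k))
    (c d : 'cV[R]_n) :
  M^T *m N \in unitmx -> M^T *m d = 0 -> (c^T *m d) 0 0 != 0 ->
  (append_col M c)^T *m append_col N d \in unitmx.
Proof.
move=> MN Md cd; rewrite /append_col; case: _ / (addn1 k).
rewrite !castmx_id tr_row_mx mul_col_row Md unitmxE det_lblock unitrM.
by rewrite -unitmxE MN det_mx11 unitfE.
Qed.

(** [inv_Pq] is semi-conjugacy of the newest direction, and [inv_L] concerns $L_k$, which is empty
    at $k=0$. [inv_p] forgets the value of $\lambda_k$. *)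
Record scg_invariant (R : realType) (n : nat) (A : 'M[R]_n) (b : 'cV[R]_n)
    (k : nat) (s : scg_state R n k) : Prop := ScgInvariant {
  inv_r : st_r s = b - A *m st_x s;
  inv_q : st_q s = A *m st_p s;
  inv_Q : st_Q s = A *m st_P s;
  inv_Pr : (st_P s)^T *m st_r s = 0;
  inv_Pq : (st_P s)^T *m st_q s = 0;
  inv_L : (st_P s)^T *m st_Q s \in unitmx;
  inv_p : exists mu : 'cV[R]_k, st_p s = st_r s - st_P s *m mu
}.

Lemma scg_invariant_curvature (R : realType) (n : nat) (A : 'M[R]_n)
    (b : 'cV[R]_n) (k : nat) (s : scg_state R n k) :
  posdef A -> scg_invariant A b s -> st_r s != 0 ->
  ((st_p s)^T *m st_q s) 0 0 != 0.
Proof.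
move=> Apos [_ qE _ Pr _ _ [mu pE]] r0.
suff /Apos : st_p s != 0 by rewrite qE mulmxA => /lt0r_neq0.
apply: contra_neq r0 => p0; apply: dotmx_eq0.
have /eqP : st_r s - st_P s *m mu = 0 by rewrite -pE.
rewrite subr_eq0 => /eqP rE.
(* With $r = P\mu$, $r^T r = \mu^T (P^T r) = 0$. *)
by rewrite {1}rE trmx_mul -mulmxA Pr mulmx0 mxE.
Qed.

Lemma scg_invariant_unit (R : realType) (n : nat) (A : 'M[R]_n)
    (b : 'cV[R]_n) (k : nat) (s : scg_state R n k) :
  posdef A -> scg_invariant A b s -> st_r s != 0 -> next_L s \in unitmx.
Proof.
move=> Apos inv r0; apply: append_col_gram_unit (inv_L inv) (inv_Pq inv) _.
exact: scg_invariant_curvature inv r0.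
Qed.

Lemma scg_step_invariant (R : realType) (n : nat) (A : 'M[R]_n)
    (b : 'cV[R]_n) (k : nat) (s : scg_state R n k) :
  posdef A -> scg_invariant A b s -> st_r s != 0 ->
  scg_invariant A b (scg_step A s).
Proof.
move=> Apos inv r0.
have pq := scg_invariant_curvature Apos inv r0.
have L := scg_invariant_unit Apos inv r0.
have QE : next_Q s = A *m next_P s.
  by rewrite /next_P mulmx_append_col -(inv_Q inv) -(inv_q inv).
split=> //=.
- by move: (_ / _) => alpha; rewrite (inv_r inv) mulmxDr -scalemxAr -(inv_q inv) opprD addrA.
- by move: (st_r s - _) => r'; rewrite QE mulmxBr [A *m (_ *m _)]mulmxA.
(* Old directions are orthogonal to both $r_k$ and $q_k$; for $p_k$, the choice of $\alpha_k$ gives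
   orthogonality. *)
- apply: append_col_orth.
    by rewrite mulmxBr -scalemxAr (inv_Pr inv) (inv_Pq inv) scaler0 subr0.
  apply/matrixP=> i j; rewrite !ord1 mulmxBr -scalemxAr.
  (* The two 1x1 products are made opaque so that [mxE] does not expand them into sums. *)
  move: ((st_p s)^T *m st_q s) ((st_p s)^T *m st_r s) pq => B C pq.
  by rewrite !mxE divfK // subrr.
(* As $\lambda$ solves $L\lambda = P^T v$, $P^T(v - Q\lambda) = 0$. *)
- move: (A *m _) => v; rewrite mulmxBr [_ *m (next_Q s *m _)]mulmxA.
  by rewrite mulKVmx // subrr.
- by eexists.
Qed.

Lemma scg_generated_invariant (R : realType) (n : nat) (A : 'M[R]_n)
    (b : 'cV[R]_n) (k : nat) :
  posdef A -> scg_generated A b k -> scg_invariant A b (scg A b k).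
Proof.
move=> Apos; elim: k => [_|k IH gen].
  split=> //=; rewrite ?mulmx0 ?subr0 //.
  - by apply/matrixP=> -[].
  - by apply/matrixP=> -[].
  - by rewrite unitmxE det_mx00 unitr1.
  - by exists 0; rewrite mulmx0 subr0.
apply: scg_step_invariant => //; last by case: (gen k (ltnSn k)).
by apply: IH => j /ltnW; apply: gen.
Qed.

(** The invertible $k\times k$ matrix $L_k = P_k^T Q_k$ has rank $k$, but it factors through
    $\mathbb{R}^n$, so its rank is at most $n$. *)
Lemma scg_generated_leq (R : realType) (n : nat) (A : 'M[R]_n)
    (b : 'cV[R]_n) (k : nat) :
  posdef A -> scg_generated A b k -> (k <= n)%N.
Proof.
move=> Apos /(scg_generated_invariant Apos) /inv_L /mxrank_unit <-.
exact: leq_trans (mxrankM_maxr _ _) (rank_leq_row _).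
Qed.

Lemma scg_generated_or_stops (R : realType) (n : nat) (A : 'M[R]_n)
    (b : 'cV[R]_n) (k : nat) :
  posdef A ->
  scg_generated A b k \/
  exists j : nat, scg_generated A b j /\ st_r (scg A b j) = 0.
Proof.
move=> Apos; elim: k => [|k [gen|stop]]; [by left| |by right].
have [r0|r0] := eqVneq (st_r (scg A b k)) 0; first by right; exists k.
left=> j; rewrite ltnS leq_eqVlt => /predU1P[->|]; last exact: gen.
have inv := scg_generated_invariant Apos gen.
split=> //; split; first exact: scg_invariant_curvature inv r0.
exact: scg_invariant_unit inv r0.
Qed.

Theorem theorem2p1 (R : realType) (n : nat) (A : 'M[R]_n) (b : 'cV[R]_n)
    (Apos : posdef A) :
  exists xstar : 'cV[R]_n,
    unique (fun x : 'cV[R]_n => A *m x = b) xstar /\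
    exists k : nat,
      [/\ (k <= n.+1)%N, scg_generated A b k & st_x (scg A b k) = xstar].
Proof.
(* At [n.+1] the first alternative would give [n.+1 <= n], so a zero residual occurs. *)
have [/(scg_generated_leq Apos)|[k [gen r0]]] :=
  scg_generated_or_stops b n.+1 Apos; first by rewrite ltnn.
exists (st_x (scg A b k)); split; last first.
  (* The argument in fact gives [k <= n], weakened here by one. *)
  by exists k; split=> //; apply/leqW/(scg_generated_leq Apos gen).
have Ax : A *m st_x (scg A b k) = b.
  apply/esym/eqP; rewrite -subr_eq0.
  by rewrite -(inv_r (scg_generated_invariant Apos gen)) r0.
split=> // y Ay; apply/eqP; rewrite -subr_eq0; apply/eqP.
by apply: (posdef_ker Apos); rewrite mulmxBr Ax Ay subrr.
Qed.
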